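(* Let $X$ be a countable semigroup and $\ell:\operatorname{dom}(\ell)\to X$ a function defined on a countable subset $\operatorname{dom}(\ell)\subset X^\omega$. The following conditions are equivalent: (1) the semigroup $X$ admits a shift-continuous metrizable topology $\tau$ in which every sequence $s\in\operatorname{dom}(\ell)$ converges to the point $\ell(s)$; (2) the semigroup $X$ admits a shift-continuous Hausdorff topology $\tau$ in which every sequence $s\in\operatorname{dom}(\ell)$ converges to the point $\ell(s)$; (3) the following two properties hold: (3a) for any $s\in\operatorname{dom}(\ell)$, $a,b\in X^1$ and $x\in X$ with $x\ne a\cdot\ell(s)\cdot b$ the set $\{n\in\omega:a\cdot s_n\cdot b=x\}$ is finite; (3b) for any $s,t\in\operatorname{dom}(\ell)$ and $a,b,c,d\in X^1$ with $a\cdot\ell(s)\cdot b\ne c\cdot\ell(t)\cdot d$ there exists a finite set $F\subset\omega$ such that $a\cdot s_n\cdot b\ne c\cdot t_m\cdot d$ for all $n,m\in\omega\setminus F$.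
   Context: $X^\omega$ is the set of all sequences $s=(s_n)_{n\in\omega}$ of elements of $X$. $X^1$ denotes the semigroup $X$ with an attached (external) unit. A topology $\tau$ on a semigroup $X$ is shift-continuous if for every $a,b\in X^1$ the two-sided shift $X\to X$, $x\mapsto axb$, is a continuous self-map of $(X,\tau)$. *)

(* Defs.v *)
From HB Require Import structures.
From mathcomp Require Import all_boot all_order all_algebra.
From mathcomp Require Import all_classical all_reals all_analysis.

Set Implicit Arguments.
Unset Strict Implicit.
Unset Printing Implicit Defensive.

Local Open Scope classical_set_scope.

(* [option X] plays the role of X^1, with [None] the external unit; it is
   attached even when X already has a unit. *)
Definition two_sided_shift (X : semigroupType) (a b : option X) (x : X) : X :=
  let ax := if a is Some a' then (a' * x)%g else x in
  if b is Some b' then (ax * b')%g else ax.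

(* Topologies on a fixed carrier are the [topologicalType] structures on it, so
   that they can be quantified over. *)
Definition topology (X : Type) : Type := Topological.axioms_ X.

Definition top_space (X : Type) (tau : topology X) : topologicalType :=
  Topological.Pack tau.

Definition metrizable (R : realType) (X : Type) (tau : topology X) : Prop :=
  exists m : Metric.axioms_ R X,
    forall U : set X, @open (Metric.Pack m) U <-> @open (top_space tau) U.

Definition hausdorff (X : Type) (tau : topology X) : Prop :=
  hausdorff_space (top_space tau).

Definition shift_continuous (X : semigroupType) (tau : topology X) : Prop :=
  forall a b : option X,
    continuous (two_sided_shift a b : top_space tau -> top_space tau).

Definition converges (X : Type) (tau : topology X) (s : nat -> X) (x : X) :
    Prop :=
  (s : nat -> top_space tau) @ \oo --> (x : top_space tau).

(* Main.v *)
Require Import Defs.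
From HB Require Import structures.
From mathcomp Require Import all_boot all_order all_algebra.
From mathcomp Require Import all_classical all_reals all_analysis.

(** The sequences [a s_n b] are countably many; give them the prescribed limits
    [a l(s) b].  Call a set closed if every such sequence whose limit lies
    outside it leaves it eventually.  By (3a) points are closed, and by (3b) so
    are a limit together with a tail of its sequence.  Hence two disjoint closed
    sets [A] and [B] can be enlarged, deciding one sequence after the other: put
    its limit and a tail into [A] if the limit is not in [B], and into [B]
    otherwise.  Starting from two points [x <> y], this yields a set separating
    [x] from [y] whose indicator is continuous along all the sequences.  The
    pullbacks of these countably many indicators under the shifts form a
    countable separating family, which therefore induces a metrizable topology;
    the family is stable under shifts, so the shifts are continuous. *)

Set Implicit Arguments.
Unset Strict Implicit.
Unset Printing Implicit Defensive.

Import Order.TTheory GRing.Theory Num.Theory.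

Local Open Scope classical_set_scope.

Lemma finite_set_nearP (A : set nat) :
  finite_set A <-> \forall n \near \oo, ~ A n.
Proof.
split=> [/finite_seqP[s ->]|[N _ AN]].
  exists (\max_(i <- s) i).+1 => // n /= ltn sn.
  by move: ltn; rewrite ltnNge leq_bigmax_seq.
apply: (sub_finite_set _ (finite_II N)) => n An /=.
by rewrite ltnNge; apply/negP => /AN.
Qed.

Lemma near_oo2P (P : nat -> nat -> Prop) :
  (exists2 F, finite_set F & forall n m, ~ F n -> ~ F m -> P n m) <->
  exists N, forall n m, (N <= n)%N -> (N <= m)%N -> P n m.
Proof.
split=> [[F /finite_set_nearP[N _ FN] FP]|[N NP]].
  by exists N => n m Nn Nm; apply: FP; exact: FN.
exists `I_N; first exact: finite_II.
by move=> n m /= /negP + /negP; rewrite -!leqNgt; exact: NP.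
Qed.

(** * Sequentially closed sets and the separation of points *)

Section sequentially_closed.
Variables (X I : Type) (u : I -> nat -> X) (p : I -> X).

Definition seq_closed (K : set X) :=
  forall i, ~ K (p i) -> \forall n \near \oo, ~ K (u i n).

Definition tail i N : set X :=
  [set x | x = p i \/ exists2 n, (N <= n)%N & x = u i n].

Lemma seq_closedU A B : seq_closed A -> seq_closed B -> seq_closed (A `|` B).
Proof.
move=> clA clB i; rewrite not_orP => -[/clA nA /clB nB].
by near=> n; rewrite not_orP; split; near: n.
Unshelve. all: by end_near. Qed.

Hypothesis avoid_point :
  forall i x, x <> p i -> \forall n \near \oo, u i n <> x.
Hypothesis avoid_seq : forall i j, p i <> p j ->
  exists N, forall n m, (N <= n)%N -> (N <= m)%N -> u i n <> u j m.

Lemma seq_closed1 x : seq_closed [set x].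
Proof. by move=> i /= /nesym; exact: avoid_point. Qed.

(** By [avoid_seq] the terms of [u j] eventually differ from all [u i k] with [k] beyond some [M].
    The limit [p i] and the finitely many terms before [M] are avoided one at a time by
    [avoid_point]. *)
Lemma seq_closed_tail i N : seq_closed (tail i N).
Proof.
move=> j /not_orP[/nesym pij uij].
have [M uM] := avoid_seq pij.
have head m : \forall n \near \oo, (forall k, (k < m)%N -> (N <= k)%N ->
    u j n <> u i k).
  elim: m => [|m IH]; first by near=> n.
  have [Nm|mN] := leqP N m; last first.
    near=> n => k; rewrite ltnS leq_eqVlt => /orP[/eqP ->|].
      by rewrite leqNgt mN.
    by move: k; near: n.
  have um : \forall n \near \oo, u j n <> u i m.
    by apply: avoid_point => ujm; apply: uij; exists m.
  near=> n => k; rewrite ltnS leq_eqVlt => /orP[/eqP -> _|].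
    by near: n.
  by move: k; near: n.
near=> n => -[|[k Nk]].
  by near: n; apply: avoid_point.
have [Mk|kM] := leqP M k.
  by apply/nesym/uM => //; near: n; exact: nbhs_infty_ge.
by move: k kM Nk; near: n.
Unshelve. all: by end_near. Qed.

Definition disjoint_closed (AB : set X * set X) :=
  [/\ seq_closed AB.1, seq_closed AB.2 & AB.1 `&` AB.2 = set0].

Definition eventually_in i (A : set X) :=
  A (p i) /\ \forall n \near \oo, A (u i n).

Lemma disjoint_closed_sym A B :
  disjoint_closed (A, B) -> disjoint_closed (B, A).
Proof. by move=> [/= ? ? AB]; split => //=; rewrite setIC. Qed.

(** As [B] is closed and misses [p i], the sequence [u i] eventually leaves [B]; a tail starting
    there can be added to [A] without meeting [B]. *)
Lemma absorb_tail i A B : disjoint_closed (A, B) -> ~ B (p i) ->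
  exists A', [/\ disjoint_closed (A', B), A `<=` A' & eventually_in i A'].
Proof.
move=> [/= clA clB AB0] Bp; have [N _ NB] := clB i Bp.
exists (A `|` tail i N); split.
- split => //=; first by apply: seq_closedU => //; exact: seq_closed_tail.
  rewrite setIUl AB0 set0U; apply/seteqP; split=> // x [[->//|[n Nn ->]]].
  exact: NB.
- exact: subsetUl.
- split; first by right; left.
  by exists N => // n /= Nn; right; right; exists n.
Qed.

Lemma decide_seq i AB : disjoint_closed AB ->
  exists AB', [/\ disjoint_closed AB', AB.1 `<=` AB'.1, AB.2 `<=` AB'.2 &
    eventually_in i AB'.1 \/ eventually_in i AB'.2].
Proof.
case: AB => A B; have [Bp|nBp] := pselect (B (p i)); last first.
  by move=> /absorb_tail /(_ nBp)[A' [? ? ?]]; exists (A', B); split=> //; left.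
move=> dAB; have nAp : ~ A (p i).
  by case: dAB => /= _ _ AB0 Ap; have : (A `&` B) (p i) by []; rewrite AB0.
have [B' [/disjoint_closed_sym ? ? ?]] :=
  absorb_tail (disjoint_closed_sym dAB) nAp.
by exists (A, B'); split=> //; right.
Qed.

Hypothesis cntI : countable [set: I].

Lemma clopen_separation x y : x <> y -> exists C : set X,
  [/\ ~ C x, C y & forall i, \forall n \near \oo, C (u i n) = C (p i)].
Proof.
move=> xy; have /countable_injP[code /in2TT code_inj] := cntI.
(* Stage [k] decides the only sequence with code [k], if there is one. Disjointness is assumed
   inside the existential so that [choice] yields a total function. *)
have step (kAB : nat * (set X * set X)) : exists AB', disjoint_closed kAB.2 ->
    [/\ disjoint_closed AB', kAB.2.1 `<=` AB'.1, kAB.2.2 `<=` AB'.2 &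
      forall i, code i = kAB.1 ->
        eventually_in i AB'.1 \/ eventually_in i AB'.2].
  case: kAB => [k AB] /=.
  have [dAB|] := pselect (disjoint_closed AB); last by exists AB.
  have [[i ik]|nok] := pselect (exists i, code i = k); last first.
    by exists AB => _; split=> // i ik; case: nok; exists i.
  have [AB' [? ? ? ?]] := decide_seq i dAB.
  by exists AB' => _; split=> // j; rewrite -ik => /code_inj ->.
have [next nextP] := choice step.
pose st := fix st n := if n is m.+1 then next (m, st m) else ([set x], [set y]).
have stP n : disjoint_closed (st n).
  elim: n => [|n IH]; last by case: (nextP (n, st n) IH).
  split; [exact: seq_closed1|exact: seq_closed1|].
  by apply/seteqP; split=> // z [/= -> /xy].
have st_mono n m : (n <= m)%N ->
    (st n).1 `<=` (st m).1 /\ (st n).2 `<=` (st m).2.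
  move=> /subnK <-; elim: (m - n)%N => [|k [IH1 IH2]]; first by split.
  have [_ /= s1 s2 _] := nextP ((k + n)%N, st (k + n)%N) (stP _).
  by split; [exact: subset_trans s1|exact: subset_trans s2].
have st_disj n m z : (st n).1 z -> ~ (st m).2 z.
  move=> nz mz; have [_ _ d0] := stP (maxn n m).
  have : ((st (maxn n m)).1 `&` (st (maxn n m)).2) z.
    split.
    - exact: (st_mono _ _ (leq_maxl n m)).1.
    - exact: (st_mono _ _ (leq_maxr n m)).2.
  by rewrite d0.
(* Since the stages increase, [st_disj] keeps whatever enters a first component out of this union.
   Sequence [i] is decided in the passage to stage [(code i).+1]. *)
exists (\bigcup_n (st n).2); split.
- by move=> [n _]; apply: (@st_disj 0).
- by exists 0%N.
- move=> i; have [_ _ _ /(_ i erefl)] := nextP (code i, st (code i)) (stP _).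
  move=> [[pi [N _ ui]]|[pi [N _ ui]]]; exists N => // n /ui uin; apply/propext.
  + by split=> -[m _ Cm]; case: (@st_disj (code i).+1 m _ _ Cm).
  + by split=> _; exists (code i).+1.
Qed.

End sequentially_closed.

(** * The metric of a countable separating family *)

Section separating_metric.
Local Open Scope ring_scope.
Context (R : realType) (X : choiceType) (K Y : Type) (F : K -> X -> Y).
Context (code : K -> nat).

(** The value 0 is adjoined to keep the set nonempty when no [F k] distinguishes [x] from [y]. *)
Definition sep_dist (x y : X) : R :=
  sup [set r | r = 0 \/ exists2 k, F k x <> F k y & r = (code k).+1%:R^-1].

Let sep_nonempty x y :
  [set r : R | r = 0 \/ exists2 k, F k x <> F k y & r = (code k).+1%:R^-1] !=set0.
Proof. by exists 0; left. Qed.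

Lemma sep_dist_le x y e : 0 <= e ->
  (forall k, F k x <> F k y -> (code k).+1%:R^-1 <= e) -> sep_dist x y <= e.
Proof. by move=> e0 eP; apply: ge_sup => // r [->//|[k /eP + ->]]. Qed.

Let sep_bounded x y : has_ubound
  [set r : R | r = 0 \/ exists2 k, F k x <> F k y & r = (code k).+1%:R^-1].
Proof. by exists 1 => r [->//|[k _ ->]]; rewrite invf_le1// ler1n. Qed.

Lemma sep_dist_ge x y k :
  F k x <> F k y -> (code k).+1%:R^-1 <= sep_dist x y.
Proof. by move=> Fk; apply: ub_le_sup => //; right; exists k. Qed.

Lemma sep_dist_ge0 x y : 0 <= sep_dist x y.
Proof. by apply: ub_le_sup => //; left. Qed.

Lemma sep_distxx x : sep_dist x x = 0.
Proof. by apply/eqP; rewrite eq_le sep_dist_ge0 sep_dist_le. Qed.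

Lemma sep_dist_sym x y : sep_dist x y = sep_dist y x.
Proof.
by apply/eqP; rewrite eq_le; apply/andP; split; apply: sep_dist_le;
  rewrite ?sep_dist_ge0// => k /nesym; exact: sep_dist_ge.
Qed.

(** An [F k] that distinguishes [x] from [z] distinguishes [y] from one of them, so a single summand
    already suffices. *)
Lemma sep_dist_triangle y x z : sep_dist x z <= sep_dist x y + sep_dist y z.
Proof.
apply: sep_dist_le => [|k Fxz]; first by rewrite addr_ge0 ?sep_dist_ge0.
have [Fxy|/sep_dist_ge xy] := pselect (F k x = F k y).
  by rewrite ler_wpDl ?sep_dist_ge0//; apply: sep_dist_ge; rewrite -Fxy.
by rewrite ler_wpDr ?sep_dist_ge0.
Qed.

Hypothesis separating : forall x y, (forall k, F k x = F k y) -> x = y.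

Lemma sep_dist_positivity x y : sep_dist x y = 0 -> x = y.
Proof.
move=> xy0; apply: separating => k; apply: contrapT => /sep_dist_ge.
by rewrite xy0 leNgt invr_gt0 ltr0n.
Qed.

(* The unused arguments let the metric instance be found from the type. *)
Definition sep_type (_ : realType) (_ : K -> nat)
  (_ : forall x y, (forall k, F k x = F k y) -> x = y) : Type := X.

Local Notation T := (sep_type R code separating).

HB.instance Definition _ := Choice.on T.
HB.instance Definition _ := @isMetric.Build R T sep_dist
  sep_distxx sep_dist_positivity sep_dist_sym sep_dist_triangle.

Hypothesis code_inj : injective code.

(** The metric thus induces the initial topology of the maps [F k] into discrete [Y]. A ball of
    radius [(code k).+1%:R^-1] forces agreement at [k]; conversely, agreement at the finitely many
    codes below [n] bounds the distance by [n.+1%:R^-1]. *)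
Lemma cvg_sepP (G : set_system T) (x : T) : Filter G ->
  G --> x <-> forall k, \forall y \near G, F k y = F k x.
Proof.
move=> FG; split=> [/fcvg_ballP Gx k|Gx].
  have /Gx : (0 : R) < (code k).+1%:R^-1 by rewrite invr_gt0 ltr0n.
  apply: filterS => y; rewrite ballEmdist /= => /lt_geF xy.
  by apply: contrapT => /nesym /sep_dist_ge; rewrite xy.
apply/fcvg_ballP => e e0.
have agree n : \forall y \near G, forall k, (code k < n)%N -> F k y = F k x.
  elim: n => [|n IH]; first by near=> y.
  have [[k0 k0n]|nok] := pselect (exists k, code k = n); last first.
    apply: filterS IH => y Fy k; rewrite ltnS leq_eqVlt => /orP[/eqP kn|/Fy//].
    by case: nok; exists k.
  near=> y => k; rewrite ltnS leq_eqVlt => /orP[/eqP kn|].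
    have -> : k = k0 by apply: code_inj; rewrite kn k0n.
    by near: y.
  by move: k; near: y.
pose n := Num.bound e^-1.
have ne : n.+1%:R^-1 < e.
  rewrite invf_plt ?posrE// (lt_trans (archi_boundP _))// ?invr_ge0 ?(ltW e0)//.
  by rewrite ltr_nat.
apply: filterS (agree n) => y Fy; rewrite ballEmdist /=.
apply: le_lt_trans ne; apply: sep_dist_le => // k Fk.
rewrite lef_pV2 ?posrE// ler_nat ltnS leqNgt.
by apply/negP => /Fy /esym.
Unshelve. all: by end_near. Qed.

End separating_metric.

Lemma separated_topology (R : realType) (X : choiceType) (K Y : Type)
    (F : K -> X -> Y) :
  countable [set: K] -> (forall x y, (forall k, F k x = F k y) -> x = y) ->
  exists2 tau : topology X, metrizable R tau &
    forall (J : Type) (G : set_system J) (f : J -> top_space tau)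
      (x : top_space tau), Filter G ->
    f @ G --> x <-> forall k, \forall j \near G, F k (f j) = F k x.
Proof.
move=> /countable_injP[code /in2TT code_inj] sepF.
exists (Topological.on (sep_type R code sepF)).
  by exists (Metric.on (sep_type R code sepF)).
by move=> J G f x FG; exact: (@cvg_sepP R X K Y F code sepF code_inj (f @ G)).
Qed.

(** * Composition of shifts, and countability of the index sets *)

Definition option_mul (X : semigroupType) (a b : option X) : option X :=
  match a, b with
  | Some a', Some b' => Some (a' * b')%g
  | None, _ => b
  | _, None => a
  end.

Lemma two_sided_shift_comp (X : semigroupType) (a b c d : option X) (x : X) :
  two_sided_shift a b (two_sided_shift c d x) =
  two_sided_shift (option_mul a c) (option_mul d b) x.
Proof.
by case: a b c d => [a|] [b|] [c|] [d|] //=; rewrite /two_sided_shift /= ?mulgA.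
Qed.

Lemma countable_option (T : Type) :
  countable [set: T] -> countable [set: option T].
Proof.
move=> /countable_injP[f /in2TT f_inj]; apply/countable_injP.
exists (oapp (fun x => (f x).+1) 0%N).
by move=> [x|] [y|] _ _ //= [/f_inj ->].
Qed.

Lemma countable_pair (T U : Type) :
  countable [set: T] -> countable [set: U] -> countable [set: T * U].
Proof. by move=> cT cU; rewrite -setXTT; exact: countableX. Qed.

Lemma countable_set_type (T : Type) (A : set T) :
  countable A -> countable [set: A].
Proof.
move=> /countable_injP[f f_inj]; apply/countable_injP; exists (f \o set_val).
move=> x y _ _ /= fxy; apply: val_inj; apply: f_inj => //; exact: valP.
Qed.

(** * Consequences of the Hausdorff property, and the equivalence *)

Lemma metrizable_hausdorff {R : realType} {X : Type} {tau : topology X} :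
  metrizable R tau -> hausdorff tau.
Proof.
move=> [m mtau]; have := @metric_hausdorff R (Metric.Pack m).
rewrite /hausdorff !open_hausdorff => sep x y /eqP xy.
have [|[A B] [xA yB] [oA oB AB0]] := sep x y; first exact/eqP.
by exists (A, B) => //; split=> //; apply/mtau.
Qed.

Lemma converges_shift {X : semigroupType} {tau : topology X} {s x} :
  shift_continuous tau -> converges tau s x -> forall a b,
  converges tau (two_sided_shift a b \o s) (two_sided_shift a b x).
Proof. by move=> ctau sx a b; apply: cvg_comp sx (ctau a b x). Qed.

Lemma converges_avoid_point {X : Type} {tau : topology X} {s x y} :
  hausdorff tau -> converges tau s x -> y <> x -> \forall n \near \oo, s n <> y.
Proof.
rewrite /hausdorff open_hausdorff => haus sx yx.
have /eqP xy : (x : top_space tau) <> y by exact: nesym.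
have [[A B] [/set_mem xA /set_mem yB] [oA oB /eqP AB0]] := haus x y xy.
have : \forall n \near \oo, A (s n) by apply: sx; exact: open_nbhs_nbhs.
apply: filterS => n Asn sny.
by have : (A `&` B) y by [split=> //; rewrite -sny]; rewrite AB0.
Qed.

Lemma converges_avoid_seq {X : Type} {tau : topology X} {s t x y} :
  hausdorff tau -> converges tau s x -> converges tau t y -> x <> y ->
  exists N, forall n m, (N <= n)%N -> (N <= m)%N -> s n <> t m.
Proof.
rewrite /hausdorff open_hausdorff => haus sx ty neq_xy.
have /eqP xy : (x : top_space tau) <> y by [].
have [[A B] [/set_mem xA /set_mem yB] [oA oB /eqP AB0]] := haus x y xy.
have [N _ NA] : \forall n \near \oo, A (s n).
  by apply: sx; exact: open_nbhs_nbhs.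
have [M _ MB] : \forall n \near \oo, B (t n).
  by apply: ty; exact: open_nbhs_nbhs.
exists (maxn N M) => n m; rewrite !geq_max => /andP[Nn _] /andP[_ Mm] st.
have : (A `&` B) (t m) by split; [rewrite -st; exact: NA|exact: MB].
by rewrite AB0.
Qed.

Theorem theorem4p1 (R : realType) (X : semigroupType)
    (dom : set (nat -> X)) (l : dom -> X) :
  countable [set: X] -> countable dom ->
  [<->
    (exists tau : topology X,
      [/\ shift_continuous tau, metrizable R tau &
          forall s : dom, converges tau (set_val s) (l s)]);
    (exists tau : topology X,
      [/\ shift_continuous tau, hausdorff tau &
          forall s : dom, converges tau (set_val s) (l s)]);
    ((forall (s : dom) (a b : option X) (x : X),
        x <> two_sided_shift a b (l s) ->
        finite_set [set n : nat | two_sided_shift a b (set_val s n) = x]) /\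
     (forall (s t : dom) (a b c d : option X),
        two_sided_shift a b (l s) <> two_sided_shift c d (l t) ->
        exists2 F : set nat, finite_set F &
          forall n m : nat, ~ F n -> ~ F m ->
            two_sided_shift a b (set_val s n) <> two_sided_shift c d (set_val t m)))].
Proof.
move=> cX cdom; tfae.
- by move=> [tau [? /metrizable_hausdorff ? ?]]; exists tau.
- move=> [tau [ctau haus cvg]].
  have cvg_shift s a b := @converges_shift X tau _ _ ctau (cvg s) a b.
  split=> [s a b x xs|s t a b c d ne].
    apply/finite_set_nearP.
    exact: (converges_avoid_point haus (cvg_shift s a b) xs).
  apply/near_oo2P.
  exact: (converges_avoid_seq haus (cvg_shift s a b) (cvg_shift t c d) ne).
- move=> [avoid_pt avoid_sq].
  have cX1 := countable_option cX.
  pose I := (option X * option X * dom)%type.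
  pose u (i : I) n := two_sided_shift i.1.1 i.1.2 (set_val i.2 n).
  pose p (i : I) := two_sided_shift i.1.1 i.1.2 (l i.2).
  have cI : countable [set: I].
    by do 2 ?apply: countable_pair => //; exact: countable_set_type.
  (* Pairs on the diagonal get the empty set, so that [choice] applies to all pairs. *)
  have sep (xy : X * X) : exists C : set X,
      (xy.1 <> xy.2 -> ~ C xy.1 /\ C xy.2) /\
      forall i, \forall n \near \oo, C (u i n) = C (p i).
    case: xy => x y; have [->|xy] := pselect (x = y).
      by exists set0; split=> // i; near=> n.
    have [||C [? ? ?]] := @clopen_separation X I u p _ _ cI x y xy.
    + by move=> [[a b] s] z /avoid_pt /finite_set_nearP.
    + by move=> [[a b] s] [[c d] t] /avoid_sq /near_oo2P.
    + by exists C.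
  have [C CP] := choice sep.
  pose K := (X * X * (option X * option X))%type.
  have cK : countable [set: K] by do 2 ?apply: countable_pair.
  pose F (k : K) : set X := fun z => C k.1 (two_sided_shift k.2.1 k.2.2 z).
  (* The identity shift [(None, None)] gives back the set [C (x, y)] itself. *)
  have Fsep x y : (forall k, F k x = F k y) -> x = y.
    move=> Fxy; apply: contrapT => xy; have [/(_ xy)[Cx Cy] _] := CP (x, y).
    by have := Fxy ((x, y), (None, None)); rewrite /F /= => E; apply: Cx;
      rewrite E.
  have [tau mtau tauP] := separated_topology R cK Fsep.
  exists tau; split=> //.
  (* Composing [F k] with a shift gives another member of the family, and applying [tauP] to the
     identity shows that every member is locally constant. *)
  + move=> a b x; apply/tauP => -[xy [c d]].
    have /tauP /(_ (xy, (option_mul c a, option_mul b d))) :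
      idfun @ nbhs (x : top_space tau) --> x by exact: cvg_id.
    by apply: filterS => z; rewrite /F /= !two_sided_shift_comp.
  (* Along [s], the member of index [(xy, (c, d))] is [C xy] along the shifted sequence of index
     [((c, d), s)]. *)
  + move=> s; apply/tauP => -[xy [c d]].
    exact: (CP xy).2 ((c, d), s).
Unshelve. all: by end_near. Qed.
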